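(* Let $\lambda,\mu,\nu\in DP$ and let $1\le a\le \ell(\mu)+1$. Then $$f^{\lambda}_{\mu\nu}\le f^{\lambda+(1^a)}_{\mu+(1^{a-1}),\,\nu+(1)}.$$
   Context: $DP$ is the set of all partitions with distinct parts, i.e. finite strictly decreasing sequences $\lambda=(\lambda_1>\cdots>\lambda_{\ell(\lambda)}>0)$ of integers, including $\emptyset$. The (shifted) diagram is $D_\lambda=\{(i,j)\mid 1\le i\le \ell(\lambda),\ i\le j\le i+\lambda_i-1\}$ (matrix coordinates); if $D_\mu\subseteq D_\lambda$, $D_{\lambda/\mu}=D_\lambda\setminus D_\mu$. For $\alpha\in DP$ and an integer $0\le a\le \ell(\alpha)+1$, $\alpha+(1^a)=(\alpha_1+1,\ldots,\alpha_a+1,\alpha_{a+1},\ldots,\alpha_{\ell(\alpha)})$, where $\alpha_{\ell(\alpha)+1}=0$; $(1)=(1^1)$. Alphabet: $1'<1<2'<2<\cdots$. A tableau of shape $D_{\lambda/\mu}$ is a filling of the boxes by letters of this alphabet, weakly increasing along rows (left to right) and down columns, such that each column contains at most one unmarked $k$ and each row at most one marked $k'$, for every $k\ge 1$. Its content $c(T)=(c_1,c_2,\ldots)$ (trailing zeros omitted) has $c_i$ = total number of entries $i$ and $i'$. Amenability: the reading word $w(T)$ reads the rows from left to right, starting with the bottom row and ending with the top row. For a word $w=w_1\cdots w_n$ in the alphabet and $i\ge1$ set $m_i(0)=0$; for $1\le j\le n$, $m_i(j)$ is the number of letters $i$ in $w_{n-j+1}\cdots w_n$; for $n+1\le j\le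 2n$, $m_i(j)=m_i(n)+$ the number of letters $i'$ in $w_1\cdots w_{j-n}$. The word is $k$-amenable if: (a) for $0\le j\le n-1$, if $m_k(j)=m_{k-1}(j)$ then $w_{n-j}\notin\{k,k'\}$; (b) for $n\le j\le 2n-1$, if $m_k(j)=m_{k-1}(j)$ then $w_{j-n+1}\notin\{k-1,k'\}$; (c) the leftmost letter of $w$ in $\{k',k\}$, if any, is $k$; (d) the leftmost letter of $w$ in $\{(k-1)',k-1\}$, if any, is $k-1$. The word is amenable if it is $k$-amenable for all $k>1$; a tableau is amenable if its reading word is. $f^\lambda_{\mu\nu}$ is the number of amenable tableaux of shape $D_{\lambda/\mu}$ and content $\nu$ (and is $0$ if $D_\mu\not\subseteq D_\lambda$). *)

(* Defs.v *)
From HB Require Import structures.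
From mathcomp Require Import all_boot finmap.

Set Implicit Arguments.
Unset Strict Implicit.
Unset Printing Implicit Defensive.

Definition DP : pred (seq nat) := [pred s | sorted gtn s && (0 \notin s)].

(* Missing parts are read as 0.  The result is again in [DP] only when
   [a <= (size s).+1]; beyond that it is a junk value. *)
Definition add_ones (a : nat) (s : seq nat) : seq nat :=
  mkseq (fun i => nth 0 s i + (i < a)) (maxn a (size s)).

Definition box : Type := (nat * nat)%type.

Definition diagram (s : seq nat) : {fset box} :=
  [fset b | b in [seq (i, j) | i <- iota 1 (size s), j <- iota i (nth 0 s i.-1)]]%fset.

Definition skew (lam mu : seq nat) : {fset box} := (diagram lam `\` diagram mu)%fset.

(* [(k, false)] is the unmarked letter k, [(k, true)] the marked letter k';
   only letters with [0 < k] belong to the alphabet. *)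
Definition letter : Type := (nat * bool)%type.

Definition letter_le (x y : letter) : bool :=
  (x.1 < y.1) || ((x.1 == y.1) && (y.2 ==> x.2)).

Section Tableaux.

Variable D : {fset box}.
Implicit Type T : {ffun D -> letter}.

Definition row_col_increasing T : bool :=
  [forall b : D, forall c : D,
     (((val b).1 == (val c).1) && ((val b).2 <= (val c).2)
      || ((val b).2 == (val c).2) && ((val b).1 <= (val c).1))
     ==> letter_le (T b) (T c)].

Definition column_condition T : bool :=
  [forall b : D, forall c : D,
     [&& (val b).2 == (val c).2, T b == T c & ~~ (T b).2] ==> (b == c)].

Definition row_condition T : bool :=
  [forall b : D, forall c : D,
     [&& (val b).1 == (val c).1, T b == T c & (T b).2] ==> (b == c)].

Definition tableau T : bool :=
  [&& [forall b : D, 0 < (T b).1], row_col_increasing T,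
      column_condition T & row_condition T].

Definition content T : seq nat :=
  mkseq (fun i => #|[set b : D | (T b).1 == i.+1]|) (\max_(b : D) (T b).1).

Definition reading_le (b c : D) : bool :=
  ((val c).1 < (val b).1)
  || (((val b).1 == (val c).1) && ((val b).2 <= (val c).2)).

Definition reading_word T : seq letter :=
  [seq T b | b <- sort reading_le (enum {: D})].

End Tableaux.

Section Amenability.

Variable w : seq letter.

Definition mcount (i j : nat) : nat :=
  if j <= size w then count_mem (i, false) (drop (size w - j) w)
  else count_mem (i, false) w + count_mem (i, true) (take (j - size w) w).

(* Letters of a word are numbered from 1. *)
Definition letter_at (p : nat) : letter := nth (0, false) w p.-1.

Definition leftmost_unmarked (i : nat) : bool :=
  if [seq x <- w | x.1 == i] is x :: _ then ~~ x.2 else true.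

Definition k_amenable (k : nat) : bool :=
  [&& all (fun j => (mcount k j == mcount k.-1 j) ==>
             (letter_at (size w - j) \notin [:: (k, false); (k, true)]))
          (iota 0 (size w)),
      all (fun j => (mcount k j == mcount k.-1 j) ==>
             (letter_at (j - size w + 1) \notin [:: (k.-1, false); (k, true)]))
          (iota (size w) (size w)),
      leftmost_unmarked k
    & leftmost_unmarked k.-1].

(* Only k up to one more than the largest letter can fail; see [amenableP]. *)
Definition amenable : bool :=
  all k_amenable (iota 2 (\max_(x <- w) x.1)).

Lemma amenableP :
  reflect (forall k, 1 < k -> k_amenable k) amenable.
Proof.
apply: (iffP allP) => [H k k1|H k]; last first.
  by rewrite mem_iota => /andP[k1 _]; exact: H.
have [kb|kb] := leqP k (\max_(x <- w) x.1).+1.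
  by apply: H; rewrite mem_iota k1 addSn add1n ltnS.
have big x : x \in w -> x.1 < k.-1.
  move=> xw; apply: (@leq_trans (\max_(x <- w) x.1).+1).
    by rewrite ltnS; exact: leq_bigmax_seq.
  by rewrite -ltnS prednK // (ltn_trans _ k1).
have bigk x : x \in w -> x.1 < k.
  by move=> /big /leq_trans; apply; exact: leq_pred.
have lu i : (forall x, x \in w -> x.1 < i) -> leftmost_unmarked i.
  move=> Hi; rewrite /leftmost_unmarked (_ : filter _ _ = [::]) //.
  apply/eqP; rewrite -[_ == _]negbK -has_filter; apply/hasPn => x /Hi.
  by rewrite neq_ltn => ->.
apply/and4P; split; try exact: lu; apply/allP => j;
  rewrite mem_iota => /andP[j1 j2]; apply/implyP => _;
  set y := letter_at _; have yw : y \in w.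
- rewrite /y /letter_at mem_nth // -subnS ltn_subrL /=.
  by apply: leq_ltn_trans j2.
- by apply/negP; rewrite !inE => /orP[]/eqP E; have := bigk _ yw; rewrite E ltnn.
- by rewrite /y /letter_at mem_nth // addn1 /= ltn_subLR.
- apply/negP; rewrite !inE => /orP[]/eqP E.
    by have := big _ yw; rewrite E ltnn.
  by have := bigk _ yw; rewrite E ltnn.
Qed.

End Amenability.

Definition amenable_tableau (lam mu nu : seq nat)
    (T : {ffun skew lam mu -> letter}) : bool :=
  [&& tableau T, content T == nu & amenable (reading_word T)].

Definition to_letter (n : nat) (x : 'I_n * bool) : letter := (x.1.+1, x.2).

Definition to_filling (lam mu : seq nat) (n : nat)
    (T : {ffun skew lam mu -> 'I_n * bool}) : {ffun skew lam mu -> letter} :=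
  [ffun b => to_letter (T b)].

(* A tableau of content nu only uses the letters 1', 1, .., n', n with
   n = size nu, so it suffices to count fillings by these letters; [fcoefE]
   shows that none is missed or counted twice. *)
Definition fcoef (lam mu nu : seq nat) : nat :=
  if (diagram mu `<=` diagram lam)%fset then
    #|[set T : {ffun skew lam mu -> 'I_(size nu) * bool}
        | amenable_tableau nu (to_filling T)]|
  else 0.

Lemma to_filling_inj lam mu n : injective (@to_filling lam mu n).
Proof.
move=> T U /ffunP E; apply/ffunP => b; have := E b; rewrite !ffunE.
case: (T b) (U b) => [i x] [j y] [] /= ij ->.
by congr (_, _); apply: val_inj.
Qed.

Lemma fcoefE lam mu nu (s : seq {ffun skew lam mu -> letter}) :
  (diagram mu `<=` diagram lam)%fset -> uniq s ->
  (forall T, (T \in s) = amenable_tableau nu T) ->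
  fcoef lam mu nu = size s.
Proof.
rewrite /fcoef => -> us Hs.
rewrite cardE -(size_map (@to_filling lam mu (size nu))).
apply/perm_size/uniq_perm => //.
  by rewrite map_inj_uniq ?enum_uniq //; exact: to_filling_inj.
move=> T; rewrite Hs; apply/mapP/idP => [[U]|HT].
  by rewrite mem_enum inE => HU ->.
have [/and4P[/forallP pos _ _ _] /eqP cont _] := and3P HT.
have lt b : (T b).1.-1 < size nu.
  rewrite -cont size_mkseq prednK //.
  exact: (leq_bigmax (F := fun b => (T b).1)).
exists [ffun b => (Ordinal (lt b), (T b).2)].
  rewrite mem_enum inE (_ : to_filling _ = T) //.
  apply/ffunP => b; rewrite !ffunE /to_letter /= prednK //.
  by case: (T b).
by apply/ffunP => b; rewrite !ffunE /to_letter /= prednK //; case: (T b).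
Qed.

(* Main.v *)
(* Insert an unmarked 1 into row a, right after the entries 1' and 1 of that row,
   moving the remaining entries of row a and all rows above it one column to the
   right.  Every column pair that becomes adjacent was related before by a
   step to the south-east, so the result is a tableau; its reading word is the old one
   with one letter 1 inserted, which keeps it amenable.  The last 1 of row a shows
   where to undo the insertion, so this map is injective. *)

Require Import Defs.
From mathcomp Require Import all_boot finmap.
From mathcomp Require Import zify.

Set Implicit Arguments.
Unset Strict Implicit.
Unset Printing Implicit Defensive.

(** * Letters as integers and shifted diagrams *)

Definition letter1 : letter := (1, false).

(** An order embedding of the alphabet into the integers whose parity records the mark (even for
    marked letters), so that all tableau conditions become linear inequalities. *)
Definition rank (x : letter) : nat := x.1.*2 + ~~ x.2.

Lemma letter_leE x y : letter_le x y = (rank x <= rank y).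
Proof. by case: x y => [i []] [j []]; rewrite /letter_le /rank /=; lia. Qed.

(** The bit [b] stands for the extra strictness of a row step or of a column step, so that one lemma
    serves both. *)
Lemma rank_ltS x y (b : bool) : x.1 < y.1 -> rank x + b <= rank y.
Proof. by rewrite /rank; case: x y b => [i []] [j []] [] /=; lia. Qed.

Lemma rank_le_fst x y (b : bool) : rank x + b <= rank y -> x.1 <= y.1.
Proof. by rewrite /rank; case: x y b => [i []] [j []] [] /=; lia. Qed.

Lemma rank_le_letter1 x : x.1 = 1 -> rank x + x.2 <= rank letter1.
Proof. by case: x => i [] /= ->. Qed.

Lemma nth_add_ones a s i : nth 0 (add_ones a s) i = nth 0 s i + (i < a).
Proof.
have [lt_i|le_i] := ltnP i (maxn a (size s)); first by rewrite nth_mkseq.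
rewrite nth_default ?size_mkseq //; move: le_i; rewrite geq_max => /andP[le_a le_s].
by rewrite nth_default // ltnNge le_a.
Qed.

Lemma mem_diagram s (i j : nat) :
  ((i, j) \in diagram s) = (0 < i) && (i <= j < i + nth 0 s i.-1).
Proof.
rewrite /diagram in_fset /=; apply/allpairsPdep/idP.
  by case=> i' [j'] []; rewrite !mem_iota => ? ? [-> ->]; lia.
move=> h; have lt_i : i.-1 < size s.
  by case: ltnP => // le_i; move: h; rewrite (nth_default 0 le_i); lia.
by exists i, j; split=> //; rewrite mem_iota; lia.
Qed.

Lemma mem_skew lam mu (i j : nat) :
  ((i, j) \in skew lam mu) =
    (0 < i) && (i + nth 0 mu i.-1 <= j < i + nth 0 lam i.-1).
Proof. by rewrite /skew in_fsetD !mem_diagram; lia. Qed.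

Lemma diagram_subset lam mu :
  (diagram mu `<=` diagram lam)%fset <-> forall i, nth 0 mu i <= nth 0 lam i.
Proof.
split=> [/fsubsetP sub i|le]; last first.
  by apply/fsubsetP => -[i j]; rewrite !mem_diagram; have := le i.-1; lia.
case mu_i: (nth 0 mu i) => [//|m].
(* This is the last box of its row in the diagram of [mu]. *)
have := sub (i.+1, i.+1 + m); rewrite !mem_diagram /= mu_i => H.
by have := H ltac:(lia); lia.
Qed.

(** Parts drop by at least one per row. Geometrically, the right ends of the rows of a shifted
    diagram never move right going down; positivity of the lower part keeps [j] inside the
    sequence. *)
Lemma DP_nth s i j :
  s \in DP -> i <= j -> 0 < nth 0 s j -> nth 0 s j + j <= nth 0 s i + i.
Proof.
case/andP=> srt _; elim: j => [|j IH]; first by rewrite leqn0 => /eqP ->.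
rewrite leq_eqVlt => /predU1P[-> //|]; rewrite ltnS => le_ij pos.
have lt_j : j.+1 < size s by case: ltnP => // le_j; rewrite (nth_default 0 le_j) in pos.
have : nth 0 s j.+1 < nth 0 s j.
  by apply: (sortedP 0 srt).
by have := IH le_ij; lia.
Qed.

Lemma DP_nth_gt0 s i : s \in DP -> i < size s -> 0 < nth 0 s i.
Proof.
case/andP=> _ nz lt_i; rewrite lt0n; apply: contra nz => /eqP <-.
exact: mem_nth.
Qed.

(** * Tableau conditions as rank inequalities *)

Section Entries.

Variable D : {fset box}.
Implicit Type T : {ffun D -> letter}.

(* Outside of [D] the junk value [(0, false)] lies below all letters. *)
Definition entry T (b : box) : letter := oapp T (0, false) (insub b).

Lemma entry_val T (b : D) : entry T (val b) = T b.
Proof. by rewrite /entry valK. Qed.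

Lemma entry_out T b : b \notin D -> entry T b = (0, false).
Proof. by move=> bD; rewrite /entry insubF //; apply: negbTE. Qed.

Lemma entry_in T (b : box) (bD : b \in D) : entry T b = T [` bD]%fset.
Proof. by rewrite -entry_val. Qed.

Lemma entry_finfun (g : box -> letter) b :
  b \in D -> entry [ffun c : D => g (val c)] b = g b.
Proof. by move=> bD; rewrite (entry_in _ bD) ffunE. Qed.

(** In a row only marked letters must increase strictly, in a column only unmarked ones; adding the
    corresponding bit to the smaller rank merges monotonicity with the row and column conditions. *)
Lemma tableauP T :
  reflect
    [/\ forall i j : nat, (i, j) \in D -> 0 < (entry T (i, j)).1,
        forall i j j' : nat, (i, j) \in D -> (i, j') \in D -> j < j' ->
          rank (entry T (i, j)) + (entry T (i, j)).2 <= rank (entry T (i, j'))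
      & forall i i' j : nat, (i, j) \in D -> (i', j) \in D -> i < i' ->
          rank (entry T (i, j)) + ~~ (entry T (i, j)).2
            <= rank (entry T (i', j))]
    (tableau T).
Proof.
apply: (iffP and4P) => [[/forallP pos /forallP inc /forallP col /forallP row]|].
  split=> [i j bD|i j j' bD cD lt|i i' j bD cD lt]; rewrite !entry_in //.
  - have /forallP/(_ [` cD]%fset)/implyP := inc [` bD]%fset.
    have /forallP/(_ [` cD]%fset)/implyP := row [` bD]%fset.
    have ne : ([` bD] == [` cD])%fset = false.
      by apply/eqP => /(congr1 val) []; lia.
    rewrite /= eqxx (ltnW lt) letter_leE ne => + /(_ isT).
    case: (T _) (T _) => [x []] [y []] /=; rewrite /rank /= ?andbT ?andbF; try lia.
    case: (eqVneq x y) => [-> /(_ (eqxx _))//|]; lia.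
  - have /forallP/(_ [` cD]%fset)/implyP := inc [` bD]%fset.
    have /forallP/(_ [` cD]%fset)/implyP := col [` bD]%fset.
    have ne : ([` bD] == [` cD])%fset = false.
      by apply/eqP => /(congr1 val) []; lia.
    rewrite /= eqxx (ltnW lt) orbT letter_leE ne => + /(_ isT).
    case: (T _) (T _) => [x []] [y []] /=; rewrite /rank /= ?andbT ?andbF; try lia.
    case: (eqVneq x y) => [-> /(_ (eqxx _))//|]; lia.
case=> pos row col; split.
- by apply/forallP => b; rewrite -entry_val; have := valP b; case: (val b) => i j /pos.
- apply/forallP => b; apply/forallP => c; apply/implyP.
  have := (valP b, valP c); rewrite letter_leE -!entry_val.
  case: (val b) (val c) => [i j] [i' j'] [bD cD] /= /orP[]/andP[/eqP e].
    rewrite -e in cD *; rewrite leq_eqVlt => /predU1P[-> //|lt].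
    by have := row _ _ _ bD cD lt; lia.
  rewrite -e in cD *; rewrite leq_eqVlt => /predU1P[-> //|lt].
  by have := col _ _ _ bD cD lt; lia.
- apply/forallP => b; apply/forallP => c; apply/implyP.
  rewrite -(inj_eq val_inj); have := (valP b, valP c); rewrite -!entry_val.
  case: (val b) (val c) => [i j] [i' j'] [bD cD] /= /and3P[/eqP e /eqP E m].
  rewrite -e in cD E *.
  case: (ltngtP i i') => [lt|gt|->]; last by rewrite eqxx.
    by have := col _ _ _ bD cD lt; rewrite E -E m; lia.
  by have := col _ _ _ cD bD gt; rewrite -E m; lia.
- apply/forallP => b; apply/forallP => c; apply/implyP.
  rewrite -(inj_eq val_inj); have := (valP b, valP c); rewrite -!entry_val.
  case: (val b) (val c) => [i j] [i' j'] [bD cD] /= /and3P[/eqP e /eqP E m].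
  rewrite -e in cD E *.
  case: (ltngtP j j') => [lt|gt|->]; last by rewrite eqxx.
    by have := row _ _ _ bD cD lt; rewrite E -E m; lia.
  by have := row _ _ _ cD bD gt; rewrite -E m; lia.
Qed.

End Entries.

(** Go right along row [i], then down column [j']. If the first letter is unmarked, its rank is odd,
    so either the row step or the column step is strict. *)
Lemma tableau_se lam mu (T : {ffun skew lam mu -> letter})
    (i j i' j' : nat) :
  lam \in DP -> tableau T ->
  (i, j) \in skew lam mu -> (i', j') \in skew lam mu -> i < i' -> j <= j' ->
  rank (entry T (i, j)) + ~~ (entry T (i, j)).2 <= rank (entry T (i', j')).
Proof.
move=> lamDP /tableauP[_ row col] bD cD lt_i le_j.
(* The corner lies right of [(i, j)], hence outside [mu], and inside [lam] because row [i] reaches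
   at least as far right as row [i']. *)
have dD : (i, j') \in skew lam mu.
  move: bD cD; rewrite !mem_skew => bD cD.
  have := @DP_nth lam i.-1 i'.-1 lamDP ltac:(lia) ltac:(lia); lia.
have := col _ _ _ dD cD lt_i.
move: le_j; rewrite leq_eqVlt => /predU1P[<-//|lt_j].
have := row _ _ _ bD dD lt_j; rewrite /rank; case: (_.2) (_.2) => [] [] /=; lia.
Qed.

(** * The insertion on tableaux and its injectivity *)

(* In row [a] the three cases read: right of the new letter, left of it, and
   the new letter itself (an entry outside the shape has first component 0). *)
Definition insert_one (a : nat) (f : box -> letter) (b : box) : letter :=
  let: (i, j) := b in
  if i < a then f (i, j.-1)
  else if i == a then
    if 1 < (f (a, j.-1)).1 then f (a, j.-1)
    else if (f (a, j)).1 == 1 then f (a, j) else letter1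
  else f (i, j).

Lemma insert_one_lt a f i j : i < a -> insert_one a f (i, j) = f (i, j.-1).
Proof. by rewrite /insert_one => ->. Qed.

Lemma insert_one_gt a f i j : a < i -> insert_one a f (i, j) = f (i, j).
Proof. by move=> gt_i; rewrite /insert_one ltnNge (ltnW gt_i) (gtn_eqF gt_i). Qed.

Definition insertion lam mu a (T : {ffun skew lam mu -> letter}) :
    {ffun skew (add_ones a lam) (add_ones a.-1 mu) -> letter} :=
  [ffun b => insert_one a (entry T) (val b)].

Section Insertion.

Variables (lam mu : seq nat) (a : nat).
Hypotheses (lamDP : lam \in DP) (muDP : mu \in DP).
Hypothesis (le_a : 1 <= a <= (size mu).+1).

Local Notation D := (skew lam mu).
Local Notation D' := (skew (add_ones a lam) (add_ones a.-1 mu)).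
Implicit Types (T : {ffun D -> letter}) (i j k : nat).

Lemma mem_skew_lt i j : i < a -> ((i, j) \in D') = (0 < j) && ((i, j.-1) \in D).
Proof. by move=> lt_i; rewrite !mem_skew !nth_add_ones; lia. Qed.

Lemma mem_skew_gt i j : a < i -> ((i, j) \in D') = ((i, j) \in D).
Proof. by move=> gt_i; rewrite !mem_skew !nth_add_ones; lia. Qed.

Lemma mem_skew_row j :
  ((a, j) \in D') = (a + nth 0 mu a.-1 <= j <= a + nth 0 lam a.-1).
Proof. by rewrite !mem_skew !nth_add_ones; lia. Qed.

Lemma entry_insertion T b :
  b \in D' -> entry (insertion a T) b = insert_one a (entry T) b.
Proof. exact: entry_finfun. Qed.

(** Says which old box supplies column [j] of the new row [a]. [RowNew] keeps what the comparisons
    need: the old neighbours on the two sides of the new letter, where they exist, have values 1 and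
    greater than 1. *)
Variant row_spec T j : letter -> Prop :=
| RowOne of (a, j) \in D & (entry T (a, j)).1 = 1 : row_spec T j (entry T (a, j))
| RowShift of 0 < j & (a, j.-1) \in D & 1 < (entry T (a, j.-1)).1 :
    row_spec T j (entry T (a, j.-1))
| RowNew of ((a, j.-1) \in D -> (entry T (a, j.-1)).1 = 1)
          & ((a, j) \in D -> 1 < (entry T (a, j)).1) : row_spec T j letter1.

Lemma rowP T j : tableau T -> (a, j) \in D' ->
  row_spec T j (insert_one a (entry T) (a, j)).
Proof.
case/tableauP=> pos _ _ bD; rewrite /insert_one ltnn eqxx.
have inD j' : 0 < (entry T (a, j')).1 -> (a, j') \in D.
  by apply: contraLR => ?; rewrite entry_out.
case: ltnP => [gt1|le1].
  by apply: RowShift => //; [move: bD; rewrite mem_skew; lia | apply: inD; lia].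
case: eqP => [eq1|ne1]; first by apply: RowOne => //; apply: inD; lia.
by apply: RowNew => /pos; lia.
Qed.

Lemma insertion_tableau T : tableau T -> tableau (insertion a T).
Proof.
move=> tabT; have [pos row col] := tableauP _ tabT; have se := tableau_se lamDP tabT.
apply/tableauP; split=> [i j bD|i j j' bD cD lt_j|i i' j bD cD lt_i].
- rewrite entry_insertion //; case: (ltngtP i a) => [lt_i|gt_i|e]; last first.
  + by rewrite e in bD *; case: (rowP tabT bD) => // *; lia.
  + by rewrite insert_one_gt // pos // -mem_skew_gt.
  + by rewrite insert_one_lt //; apply: pos; move: bD; rewrite mem_skew_lt; lia.
- rewrite !entry_insertion //; case: (ltngtP i a) => [lt_i|gt_i|e]; last first.
  + rewrite e in bD cD *.
    move: (bD) (cD); rewrite !mem_skew_row => bI cI.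
    have memD k : ((a, k) \in D)
        = (a + nth 0 mu a.-1 <= k < a + nth 0 lam a.-1) by rewrite mem_skew; lia.
    (* Old letters 1' and 1, then the new letter, then shifted letters is the order to verify; the
       three reversed pairs contradict monotonicity of the old row, and an unmarked 1 may repeat in
       a row. *)
    case: (rowP tabT bD) => [b1D b1|j0 b1D b1|b1 b2];
      case: (rowP tabT cD) => [c1D c1|j0' c1D c1|c1 c2].
    * exact: row.
    * by apply: rank_ltS; rewrite b1.
    * exact: rank_le_letter1.
    * by have := rank_le_fst (row _ _ _ b1D c1D ltac:(lia)); rewrite c1 leqNgt b1.
    * by apply: row => //; lia.
    * have b2D : (a, j'.-1) \in D by move: b1D; rewrite !memD; lia.
      have := rank_le_fst (row _ _ _ b1D b2D ltac:(lia)).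
      by rewrite (c1 b2D) leqNgt b1.
    * have b2D : (a, j) \in D by move: c1D; rewrite !memD; lia.
      by have := rank_le_fst (row _ _ _ b2D c1D lt_j); rewrite c1 leqNgt b2.
    * exact: rank_ltS.
    * by [].
  + rewrite !insert_one_gt //.
    by apply: row; rewrite -?mem_skew_gt.
  + rewrite !insert_one_lt //; move: bD cD; rewrite !mem_skew_lt //.
    by move=> /andP[j0 bD] /andP[j0' cD]; apply: row => //; lia.
rewrite !entry_insertion //.
have [lt_ia|gt_ia|e_ia] := ltngtP i a; last first.
- rewrite e_ia in bD lt_i *; move: (cD); rewrite mem_skew_gt // => c1D.
  rewrite (insert_one_gt _ _ lt_i).
  case: (rowP tabT bD) => [b1D b1|j0 b1D b1|b1 b2].
  + exact: col.
  + by apply: se => //; lia.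
  (* Row [i'] of [lam] does not reach beyond row [a], so nothing lies below the box added at the end
     of row [a]; hence column [j] was already occupied in row [a], by a letter larger than 1. *)
  + have b2D : (a, j) \in D.
      move: bD c1D; rewrite mem_skew_row !mem_skew => bI cI.
      by have := @DP_nth lam a.-1 i'.-1 lamDP ltac:(lia) ltac:(lia); lia.
    by apply: rank_ltS; apply: leq_trans (b2 b2D) (rank_le_fst (col _ _ _ b2D c1D lt_i)).
- have gt_i'a := ltn_trans gt_ia lt_i.
  rewrite !insert_one_gt //.
  by apply: col; rewrite -?mem_skew_gt.
move: (bD); rewrite mem_skew_lt // => /andP[j0 b1D].
rewrite (insert_one_lt _ _ lt_ia).
have [lt_i'a|gt_i'a|e_i'a] := ltngtP i' a.
- rewrite insert_one_lt //; apply: col => //.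
  by move: cD; rewrite mem_skew_lt // => /andP[].
- rewrite insert_one_gt //.
  by apply: se => //; [rewrite -mem_skew_gt | lia].
rewrite e_i'a in cD lt_i *.
case: (rowP tabT cD) => [c1D c1|_ c1D c1|c1 c2].
- by apply: se => //; lia.
- exact: col.
(* The new letter cannot start row [a] with a box above it: the rows of [mu] above end at least as
   far right as row [a] does after its shift. The bound on [a] enters here, making the part of [mu]
   before [a] positive. *)
have c1D : (a, j.-1) \in D.
  move: cD b1D; rewrite mem_skew_row !mem_skew => cI bI.
  have mu_gt0 : 0 < nth 0 mu a.-2 by apply: DP_nth_gt0 => //; lia.
  have := @DP_nth mu i.-1 a.-2 muDP ltac:(lia) mu_gt0.
  have mu_a : nth 0 mu a.-1 + a.-1 <= nth 0 mu a.-2 + a.-2.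
    case: (posnP (nth 0 mu a.-1)) => [->|]; first lia.
    by apply: DP_nth => //; lia.
  lia.
(* The old letter at [(a, j.-1)] is 1' or 1, so the letter above it must be 1', which may stand
   above the new 1. *)
have le := col _ _ _ b1D c1D lt_i; move: (rank_le_fst le); rewrite (c1 c1D).
rewrite leq_eqVlt ltnS leqn0 eqn0Ngt pos // orbF => /eqP eq1.
move: le; rewrite /rank eq1 (c1 c1D).
by case: (_.2) (_.2) => [] [].
Qed.

Lemma insertion_inj T U : tableau T -> tableau U ->
  insertion a T = insertion a U -> T = U.
Proof.
move=> tabT tabU eqTU.
have eqI i j : (i, j) \in D' ->
    insert_one a (entry T) (i, j) = insert_one a (entry U) (i, j).
  by move=> bD; rewrite -!entry_insertion // eqTU.
have memD k : ((a, k) \in D)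
    = (a + nth 0 mu a.-1 <= k < a + nth 0 lam a.-1) by rewrite mem_skew; lia.
suff eqE i j : (i, j) \in D -> entry T (i, j) = entry U (i, j).
  by apply/ffunP => b; rewrite -!entry_val; have := valP b; case: (val b).
move=> bD; have [lt_i|gt_i|e_i] := ltngtP i a.
- have := eqI i j.+1; rewrite !insert_one_lt //; apply.
  by rewrite mem_skew_lt.
- have := eqI i j; rewrite mem_skew_gt // => /(_ bD).
  by rewrite !insert_one_gt.
rewrite {}e_i in bD *.
have := eqI a j ltac:(by move: bD; rewrite mem_skew_row memD; lia).
have := eqI a j.+1 ltac:(by move: bD; rewrite mem_skew_row memD; lia).
(* The letter at column [j.+1] of the new row tells whether the old entry of column [j] stayed
   (value 1) or moved right (value above 1), and so where to read it off. *)
have small (V : {ffun D -> letter}) : tableau V -> (entry V (a, j)).1 <= 1 ->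
    insert_one a (entry V) (a, j) = entry V (a, j)
    /\ (insert_one a (entry V) (a, j.+1)).1 = 1.
  move=> tabV le1; have [pos row _] := tableauP _ tabV.
  have eq1 : (entry V (a, j)).1 = 1 by have := pos _ _ bD; lia.
  rewrite /insert_one ltnn eqxx /= eq1 ltnn eqxx; split; last by case: eqP.
  case: ltnP => // gt1.
  have b1D : (a, j.-1) \in D by move: gt1; apply: contraLR => /entry_out ->.
  have lt_j : j.-1 < j by move: bD b1D; rewrite !memD; lia.
  by have := rank_le_fst (row _ _ _ b1D bD lt_j); rewrite eq1 leqNgt gt1.
have large (V : {ffun D -> letter}) : 1 < (entry V (a, j)).1 ->
    insert_one a (entry V) (a, j.+1) = entry V (a, j).
  by rewrite /insert_one ltnn eqxx /= => ->.
have [leT|gtT] := leqP (entry T (a, j)).1 1;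
  have [leU|gtU] := leqP (entry U (a, j)).1 1.
- by rewrite (small T tabT leT).1 (small U tabU leU).1.
- by rewrite (large U gtU) => E; move: gtU; rewrite -E (small T tabT leT).2.
- by rewrite (large T gtT) => E; move: gtT; rewrite E (small U tabU leU).2.
- by rewrite (large T gtT) (large U gtU).
Qed.

End Insertion.

(** * Inserting a letter 1 into an amenable word *)

Definition occ (x : letter) (w : seq letter) : nat := count_mem x w.

Lemma occ_cat x u v : occ x (u ++ v) = occ x u + occ x v.
Proof. exact: count_cat. Qed.

Lemma occ_cons x y w : occ x (y :: w) = (y == x) + occ x w.
Proof. by []. Qed.

Lemma mcountE w i j :
  mcount w i j =
    if j <= size w then occ (i, false) (drop (size w - j) w)
    else occ (i, false) w + occ (i, true) (take (j - size w) w).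
Proof. by []. Qed.

(** Position indices are replaced by factorizations around the inspected letter [y]: the first pass
    has read the suffix [z], the second pass the whole word and then the prefix [x]. Insertions are
    easier to follow in this form. *)
Definition k_amenable_split (w : seq letter) (k : nat) : Prop :=
  [/\ forall x y z, w = x ++ y :: z ->
        occ (k, false) z = occ (k.-1, false) z ->
        y \notin [:: (k, false); (k, true)],
      forall x y z, w = x ++ y :: z ->
        occ (k, false) w + occ (k, true) x
          = occ (k.-1, false) w + occ (k.-1, true) x ->
        y \notin [:: (k.-1, false); (k, true)],
      leftmost_unmarked w k
    & leftmost_unmarked w k.-1].

Lemma k_amenableP w k : reflect (k_amenable_split w k) (k_amenable w k).
Proof.
have drop_last (x : seq letter) y z :
  drop (size (x ++ y :: z) - size z) (x ++ y :: z) = z.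
  by rewrite size_cat /= addnS -addSn addnK drop_cat ltnNge leqnSn subSnn /= drop0.
have split_nth j : j < size w -> w = take j w ++ nth (0, false) w j :: drop j.+1 w.
  by move=> lt_j; rewrite -drop_nth // cat_take_drop.
apply: (iffP and4P) => [[/allP A /allP B lk lk1]|[A B lk lk1]]; split=> //.
- move=> x y z E cnt; have := A (size z).
  have szw : size w = size x + (size z).+1 by rewrite E size_cat.
  rewrite mem_iota => /(_ ltac:(lia))/implyP.
  rewrite !mcountE !ifT; try lia.
  have -> : drop (size w - size z) w = z by rewrite E drop_last.
  rewrite cnt eqxx => /(_ isT); rewrite /letter_at szw addnS -addSn addnK /=.
  by rewrite E nth_cat ltnn subnn.
- move=> x y z E cnt; have := B (size w + size x).
  have szw : size w = size x + (size z).+1 by rewrite E size_cat.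
  rewrite mem_iota => /(_ ltac:(lia))/implyP.
  have mE i : mcount w i (size w + size x) = occ (i, false) w + occ (i, true) x.
    (* For empty [x] the index is [size w], which [mcount] treats in its first branch; both branches
       agree there. *)
    rewrite mcountE; case: ifP => [le|_]; last by rewrite addKn E take_size_cat.
    have -> : x = [::] by apply: size0nil; lia.
    by rewrite addn0 subnn drop0 addn0.
  rewrite !mE cnt eqxx => /(_ isT).
  by rewrite /letter_at addKn addn1 /= E nth_cat ltnn subnn.
- apply/allP => j; rewrite mem_iota => lt_j; apply/implyP => /eqP.
  rewrite !mcountE !ifT; try lia; move=> cnt.
  apply: (A (take (size w - j).-1 w) _ (drop (size w - j) w)) => //.
  by rewrite {1}(split_nth (size w - j).-1) ?prednK //; lia.
- apply/allP => j; rewrite mem_iota => lt_j; apply/implyP => /eqP cnt.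
  have mE i : mcount w i j = occ (i, false) w + occ (i, true) (take (j - size w) w).
    rewrite mcountE; case: ifP => // le.
    have -> : j = size w by lia.
    by rewrite subnn drop0 take0 addn0.
  apply: (B (take (j - size w) w) _ (drop (j - size w).+1 w)); last by rewrite -!mE.
  by rewrite /letter_at addn1 /= -split_nth //; lia.
Qed.

(** Reading one more letter raises the left count by at most one, and condition (a) forbids this
    when the two counts agree. *)
Lemma k_amenable_suffix w k x z : k_amenable w k -> w = x ++ z ->
  occ (k, false) z <= occ (k.-1, false) z.
Proof.
case/k_amenableP=> A _ _ _; elim: z x => // y z IH x E; rewrite !occ_cons.
have le_z := IH (rcons x y) ltac:(by rewrite cat_rcons).
have := A _ _ _ E; move: le_z; rewrite leq_eqVlt => /predU1P[e|].
  by move/(_ e); rewrite !inE negb_or => /andP[/negbTE-> _]; lia.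
by case: (y == _); case: (y == _) => /=; lia.
Qed.

(** The same argument for the second pass, with condition (b); it starts from the bound for the
    whole word reached at the end of the first pass. *)
Lemma k_amenable_prefix w k x z : k_amenable w k -> w = x ++ z ->
  occ (k, false) w + occ (k, true) x
    <= occ (k.-1, false) w + occ (k.-1, true) x.
Proof.
move=> am; have /k_amenableP[_ B _ _] := am.
elim/last_ind: x z => [|x y IH] z E.
  by rewrite !addn0; apply: k_amenable_suffix am (erefl : w = [::] ++ w).
rewrite cat_rcons in E; rewrite -cats1 !occ_cat !occ_cons !addn0.
have := B _ _ _ E; have := IH _ E; rewrite leq_eqVlt => /predU1P[e|].
  by move/(_ e); rewrite !inE negb_or => /andP[_ /negbTE->]; lia.
by case: (y == _); case: (y == _) => /=; lia.
Qed.

Lemma insert_split (A : Type) (u v x z : seq A) (c y : A) :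
  u ++ c :: v = x ++ y :: z ->
  [\/ exists2 t, u = x ++ y :: t & z = t ++ c :: v,
      [/\ u = x, c = y & v = z]
    | exists2 t, x = u ++ c :: t & v = t ++ y :: z].
Proof.
elim: u x => [|b u IH] [|d x] /=.
- by case=> -> ->; apply: Or32.
- by case=> -> ->; apply: Or33; exists x.
- by case=> -> <-; apply: Or31; exists u.
case=> -> /IH[[t -> ->]|[-> -> ->]|[t -> ->]].
- by apply: Or31; exists t.
- exact: Or32.
- by apply: Or33; exists t.
Qed.

(* Past the inserted letter, [m_1] exceeds [m_2] strictly, so the conditions for
   [k = 2] become vacuous there; for larger [k] the letter is not counted. *)
Lemma k_amenable_insert u v k : 1 < k ->
  k_amenable (u ++ v) k -> k_amenable (u ++ letter1 :: v) k.
Proof.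
move=> k1 am; have /k_amenableP[A B lk lk1] := am.
have letter1_k b : (letter1 == (k, b)) = false by apply/eqP => -[]; lia.
have letter1_k1 : (letter1 == (k.-1, true)) = false by apply/eqP => -[].
apply/k_amenableP; split.
- move=> x y z E0; case: (insert_split E0) => [[t Eu Ez]|[Eu <- _]|[t Ex Ev]].
  + have E : u ++ v = x ++ y :: (t ++ v) by rewrite Eu -catA.
    have := k_amenable_suffix am (etrans E (esym (cat_rcons _ _ _))).
    rewrite Ez !occ_cat ?occ_cons letter1_k; have := A _ _ _ E; rewrite !occ_cat.
    case: (letter1 == _) => /= [|H _]; [lia | by rewrite !add0n].
  + by rewrite !inE !letter1_k.
  + by apply: (A (u ++ t)); rewrite Ev catA.
- move=> x y z E0; case: (insert_split E0) => [[t Eu Ez]|[Eu <- _]|[t Ex Ev]].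
  + have E : u ++ v = x ++ y :: (t ++ v) by rewrite Eu -catA.
    have := k_amenable_prefix am E.
    have := B _ _ _ E; rewrite !occ_cat ?occ_cons letter1_k.
    case: (letter1 == _) => /= [|H _]; [lia | by rewrite !add0n].
  (* For [k = 2] the inspected letter is the inserted 1, which (b) would forbid at equality;
     equality fails because the total number of 1s has grown. *)
  + rewrite !inE letter1_k orbF; have := k_amenable_prefix am (erefl (u ++ v)).
    rewrite -Eu !occ_cat ?occ_cons letter1_k; case: (letter1 == _) => //=; lia.
  + have E : u ++ v = (u ++ t) ++ y :: z by rewrite Ev catA.
    have := k_amenable_prefix am E.
    have := B _ _ _ E; rewrite Ex !occ_cat ?occ_cons !letter1_k letter1_k1.
    case: (letter1 == _) => /= [|H _]; [lia | by rewrite !add0n].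
- by move: lk; rewrite /leftmost_unmarked !filter_cat /= (_ : (1 == k) = false) //; lia.
(* For [k = 2] the leftmost letter 1' or 1 is either unchanged inside [u] or the inserted letter
   itself, which is unmarked. *)
move: lk1; rewrite /leftmost_unmarked !filter_cat /=.
by case: ifP => // _; case: [seq _ <- u | _].
Qed.

Lemma amenable_insert u v : amenable (u ++ v) -> amenable (u ++ letter1 :: v).
Proof. by move=> /amenableP am; apply/amenableP => k k1; apply/k_amenable_insert/am. Qed.

Definition word_content (w : seq letter) : seq nat :=
  mkseq (fun i => count (fun x => x.1 == i.+1) w) (\max_(x <- w) x.1).

Lemma word_content_insert u v :
  word_content (u ++ letter1 :: v) = add_ones 1 (word_content (u ++ v)).
Proof.
have maxE : \max_(x <- u ++ letter1 :: v) x.1 = maxn 1 (\max_(x <- u ++ v) x.1).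
  by rewrite !big_cat big_cons /= maxnCA.
rewrite /add_ones size_mkseq /word_content maxE; apply: eq_mkseq => i.
rewrite !count_cat /= addnCA addnC -count_cat ltnS leqn0 eq_sym; congr (_ + _)%N.
  have [lt_i|le_i] := ltnP i (\max_(x <- u ++ v) x.1); first by rewrite nth_mkseq.
  (* The old content has no entry here; its default 0 is the right count, as no letter exceeds the
     maximum. *)
  rewrite nth_default ?size_mkseq //; apply/eqP; rewrite -leqn0 leqNgt -has_count.
  apply/hasPn => x xw; apply: contraTN le_i => /eqP xi.
  by rewrite -ltnNge -xi; apply: leq_bigmax_seq.
Qed.

(** * Reading words listed row by row *)

Definition box_le (b c : box) : bool :=
  (c.1 < b.1) || ((b.1 == c.1) && (b.2 <= c.2)).

Lemma box_le_trans : transitive box_le.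
Proof. by move=> [i j] [i' j'] [i'' j'']; rewrite /box_le /=; lia. Qed.

Lemma box_le_anti : antisymmetric box_le.
Proof.
by move=> [i j] [i' j']; rewrite /box_le /= => h; congr (_, _); lia.
Qed.

Lemma box_le_total : total box_le.
Proof. by move=> [i j] [i' j']; rewrite /box_le /=; lia. Qed.

(** The boxes in reading order, from row [n] up to row 1. The bound [n] is free, so that the old and
    the new shape can be listed over the same rows. *)
Fixpoint skew_boxes (lam mu : seq nat) (n : nat) : seq box :=
  if n is m.+1 then
    [seq (n, j) | j <- iota (n + nth 0 mu m) (nth 0 lam m - nth 0 mu m)]
      ++ skew_boxes lam mu m
  else [::].

Lemma mem_skew_boxes lam mu n (i j : nat) :
  ((i, j) \in skew_boxes lam mu n) = (i <= n) && ((i, j) \in skew lam mu).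
Proof.
elim: n => [|n IH]; first by rewrite mem_skew; case: i.
rewrite mem_cat {}IH mem_skew.
have -> : ((i, j) \in [seq (n.+1, j0) | j0 <-
    iota (n.+1 + nth 0 mu n) (nth 0 lam n - nth 0 mu n)])
  = (i == n.+1) && (n.+1 + nth 0 mu n <= j < n.+1 + nth 0 lam n).
  apply/mapP/andP => [[j' + [-> ->]]|[/eqP -> jI]]; first by rewrite mem_iota; lia.
  by exists j => //; rewrite mem_iota; lia.
have [-> /=|ne] := eqVneq i n.+1; last by rewrite [i <= n.+1]leq_eqVlt (negbTE ne).
by rewrite ltnn leqnn orbF.
Qed.

Lemma skew_boxes_sorted lam mu n :
  uniq (skew_boxes lam mu n) && pairwise box_le (skew_boxes lam mu n).
Proof.
elim: n => //= n /andP[un pn].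
rewrite cat_uniq pairwise_cat un pn map_inj_uniq ?iota_uniq; last by move=> ? ? [].
rewrite !andbT /=; apply/and3P; split.
- apply/hasPn => -[i j]; rewrite mem_skew_boxes => /andP[le_i _].
  by apply/mapP => -[j' _ [e _]]; lia.
- apply/allrelP => _ [i j] /mapP[j' _ ->]; rewrite mem_skew_boxes => /andP[le_i _].
  by rewrite /box_le /=; lia.
- rewrite pairwise_map; apply: sub_pairwise (_ : pairwise leq _) => [j j' /=|].
    by rewrite /box_le eqxx ltnn.
  by rewrite -sorted_pairwise ?iota_sorted //; exact: leq_trans.
Qed.

Lemma skew_row_le_size lam mu (i j : nat) : (i, j) \in skew lam mu -> i <= size lam.
Proof.
rewrite mem_skew; case: (leqP i (size lam)) => // lt_i.
by rewrite (@nth_default _ 0 lam); lia.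
Qed.

(** Both lists of boxes enumerate the same set and are sorted for the same antisymmetric order,
    hence coincide. *)
Lemma reading_wordE lam mu n (T : {ffun skew lam mu -> letter}) :
  size lam <= n -> reading_word T = [seq entry T b | b <- skew_boxes lam mu n].
Proof.
move=> le_n; rewrite /reading_word.
rewrite (eq_map (fun b => esym (entry_val T b))) map_comp; congr map.
have /andP[un pn] := skew_boxes_sorted lam mu n.
apply: (sorted_eq box_le_trans box_le_anti).
- rewrite sorted_map; apply: sort_sorted => b c; exact: box_le_total.
- exact: pairwise_sorted.
apply: uniq_perm => // [|[i j]].
  by rewrite map_inj_uniq ?sort_uniq ?enum_uniq //; exact: val_inj.
rewrite mem_skew_boxes; apply/mapP/andP => [[b _ E]|[_ bD]]; last first.
  by exists [` bD]%fset; rewrite ?mem_sort ?mem_enum.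
have bD : (i, j) \in skew lam mu by rewrite E (valP b).
by split=> //; exact: leq_trans (skew_row_le_size bD) le_n.
Qed.

Lemma contentE (D : {fset box}) (T : {ffun D -> letter}) :
  content T = word_content (reading_word T).
Proof.
have pe : perm_eq (reading_word T) [seq T b | b <- enum {: D}].
  by apply: perm_map; rewrite perm_sort.
rewrite /content /word_content (perm_big _ pe) big_map big_enum /=.
apply: eq_mkseq => i; rewrite (permP pe) count_map -size_filter cardE.
congr size; rewrite enumT; apply: eq_filter => b; by rewrite /= inE.
Qed.

(** * The effect of the insertion on the reading word *)

Lemma threshold (g : nat -> nat) s L :
  (forall j, s <= j < s + L -> 0 < g j) ->
  (forall j j', s <= j -> j < j' < s + L -> g j <= g j') ->
  exists p, [/\ p <= L, forall j, s <= j < s + p -> g j = 1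
                & forall j, s + p <= j < s + L -> 1 < g j].
Proof.
elim: L => [|L IH] pos mono; first by exists 0; split=> // j; lia.
have [||p [le_p small large]] := IH.
- by move=> j jI; apply: pos; lia.
- by move=> j j' jI jI'; apply: mono; lia.
have [e|ne] := eqVneq p L.
  case: (leqP (g (s + L)) 1) => gL.
    exists L.+1; split=> // j jI; last lia.
    have [->|ne] := eqVneq j (s + L); last by apply: small; lia.
    by have := pos (s + L) ltac:(lia); lia.
  exists L; split=> // j jI; first by apply: small; lia.
  by have -> : j = s + L by lia.
exists p; split=> // [|j jI]; first lia.
have [->|ne'] := eqVneq j (s + L); last by apply: large; lia.
by have := large (s + p) ltac:(lia);
  have := mono (s + p) (s + L) ltac:(lia) ltac:(lia); lia.
Qed.

(** With [p] the number of letters 1' and 1 in the row, the new letter lands in column [s + p]. The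
    value 0 just outside the row makes the comparisons come out right when [p] is 0 or [L]. *)
Lemma insert_one_row a f s L : 0 < s ->
  (forall j, s <= j < s + L -> 0 < (f (a, j)).1) ->
  (forall j j', s <= j -> j < j' < s + L -> (f (a, j)).1 <= (f (a, j')).1) ->
  (f (a, s.-1)).1 = 0 -> (f (a, s + L)).1 = 0 ->
  exists u v, [seq f (a, j) | j <- iota s L] = u ++ v
    /\ [seq insert_one a f (a, j) | j <- iota s L.+1] = u ++ letter1 :: v.
Proof.
move=> s0 pos mono f_lo f_hi.
have [p [le_p small large]] := threshold pos mono.
exists [seq f (a, j) | j <- iota s p], [seq f (a, j) | j <- iota (s + p) (L - p)].
split; first by rewrite -map_cat -iotaD subnKC.
have -> : L.+1 = p + (L - p).+1 by lia.
rewrite iotaD map_cat /=; congr (_ ++ _ :: _).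
- apply/eq_in_map => j; rewrite mem_iota => jI; rewrite ltnn eqxx (small j) //.
  case: (eqVneq j s) => [->|ne]; first by rewrite f_lo.
  by rewrite (small j.-1) //; lia.
- rewrite ltnn eqxx ifN; last first.
    case: (posnP p) => [->|p0]; first by rewrite addn0 f_lo.
    by rewrite (small (s + p).-1) //; lia.
  case: eqP => // e1; have [e|ne] := eqVneq p L; first by move: e1; rewrite e f_hi.
  by have := large (s + p) ltac:(lia); rewrite e1.
rewrite -[(s + p).+1]/(1 + (s + p)) iotaDl -map_comp.
apply/eq_in_map => j; rewrite mem_iota => jI.
by rewrite /= add1n ltnn eqxx large //; lia.
Qed.

Section ReadingWord.

Variables (lam mu : seq nat) (a : nat) (T : {ffun skew lam mu -> letter}).
Hypotheses (a0 : 0 < a) (sub : forall i, nth 0 mu i <= nth 0 lam i).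
Hypothesis tabT : tableau T.

Let boxes' := skew_boxes (add_ones a lam) (add_ones a.-1 mu).

Lemma insert_one_above n : n < a ->
  [seq insert_one a (entry T) b | b <- boxes' n]
    = [seq entry T b | b <- skew_boxes lam mu n].
Proof.
elim: n => // n IH lt_n; rewrite /= !map_cat {}IH ?(ltnW lt_n) //; congr (_ ++ _).
rewrite !nth_add_ones (ltnW lt_n) (_ : n < a.-1); last lia.
rewrite addnA subnDr addnC iotaDl -!map_comp; apply: eq_map => j.
by rewrite /= lt_n.
Qed.

Lemma insert_one_word n : a <= n ->
  exists u v, [seq entry T b | b <- skew_boxes lam mu n] = u ++ v
    /\ [seq insert_one a (entry T) b | b <- boxes' n] = u ++ letter1 :: v.
Proof.
elim: n => [|n IH]; first lia.
rewrite leq_eqVlt => /predU1P[e|lt_a]; last first.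
  have [u [v [Eu Ev]]] := IH lt_a.
  set r := [seq entry T (n.+1, j) | j <- iota (n.+1 + nth 0 mu n)
    (nth 0 lam n - nth 0 mu n)].
  exists (r ++ u), v; rewrite /= !map_cat Eu Ev -!catA -!map_comp; split=> //.
  congr (_ ++ _); rewrite !nth_add_ones.
  have [-> ->] : (n < a) = false /\ (n < a.-1) = false by lia.
  by rewrite !addn0; apply: eq_map => j; exact: insert_one_gt.
(* Row [a] itself: it is split at the new letter, and the unchanged words of the rows above go into
   the right factor. *)
have [pos row _] := tableauP _ tabT.
have memD j : ((a, j) \in skew lam mu)
    = (a + nth 0 mu n <= j < a + nth 0 lam n) by rewrite mem_skew e /=; lia.
have le_n := sub n.
have [||||| u [v [Eu Ev]]] :=
  @insert_one_row a (entry T) (a + nth 0 mu n) (nth 0 lam n - nth 0 mu n).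
- lia.
- by move=> j jI; apply: pos; rewrite memD; lia.
- by move=> j j' jI jI'; apply/rank_le_fst/row; rewrite ?memD; lia.
- by rewrite entry_out // memD; lia.
- by rewrite entry_out // memD; lia.
exists u, (v ++ [seq entry T b | b <- skew_boxes lam mu n]).
rewrite /boxes' /= !map_cat insert_one_above ?e // -!map_comp -e catA -Eu.
rewrite -cat_cons catA -Ev !nth_add_ones; split=> //; congr (_ ++ _).
have [-> ->] : (n < a) = true /\ (n < a.-1) = false by lia.
by rewrite addn0 addn1 subSn.
Qed.

Lemma reading_word_insertion :
  exists u v, reading_word T = u ++ v
    /\ reading_word (insertion a T) = u ++ letter1 :: v.
Proof.
(* Row [a] may lie just below [lam]; this [n] bounds the rows of both shapes. *)
pose n := maxn a (size lam).
have [u [v [Eu Ev]]] := insert_one_word (leq_maxl a (size lam) : a <= n).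
exists u, v; split; first by rewrite (reading_wordE _ (leq_maxr a (size lam))).
rewrite (@reading_wordE _ _ n) ?size_mkseq // -Ev; apply/eq_in_map => -[i j].
by rewrite mem_skew_boxes => /andP[_ bD]; rewrite entry_insertion.
Qed.

End ReadingWord.

(** * Comparing the two counts *)

Lemma insertion_amenable_tableau lam mu nu a (T : {ffun skew lam mu -> letter}) :
  lam \in DP -> mu \in DP -> 1 <= a <= (size mu).+1 ->
  (forall i, nth 0 mu i <= nth 0 lam i) ->
  amenable_tableau nu T -> amenable_tableau (add_ones 1 nu) (insertion a T).
Proof.
move=> lamDP muDP le_a sub /and3P[tabT /eqP cont amT].
have a0 : 0 < a by case/andP: le_a.
have [u [v [Eu Ev]]] := reading_word_insertion a0 sub tabT.
apply/and3P; split; first exact: insertion_tableau.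
- by rewrite -cont !contentE Eu Ev word_content_insert.
- by rewrite Ev; apply: amenable_insert; rewrite -Eu.
Qed.

(** A tableau of content [nu] has letters of value at most [size nu], so every member of [s] comes
    from one of the fillings counted by [fcoef]. *)
Lemma leq_size_fcoef lam mu nu (s : seq {ffun skew lam mu -> letter}) :
  (diagram mu `<=` diagram lam)%fset -> uniq s ->
  all (amenable_tableau nu) s -> size s <= fcoef lam mu nu.
Proof.
rewrite /fcoef => -> us /allP ams.
rewrite cardE -(size_map (@to_filling lam mu (size nu))).
apply: uniq_leq_size => // T /ams amT; apply/mapP.
have [/and4P[/forallP pos _ _ _] /eqP cont _] := and3P amT.
have lt b : (T b).1.-1 < size nu.
  rewrite -cont size_mkseq prednK //.
  exact: (leq_bigmax (F := fun b => (T b).1)).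
have ET : T = to_filling [ffun b => (Ordinal (lt b), (T b).2)].
  apply/ffunP => b; rewrite !ffunE /to_letter /= prednK //.
  by case: (T b).
by exists [ffun b => (Ordinal (lt b), (T b).2)]; rewrite // mem_enum inE -ET.
Qed.

Theorem lemma3p9 (lam mu nu : seq nat) (a : nat)
    (hlam : lam \in DP) (hmu : mu \in DP) (hnu : nu \in DP)
    (ha : 1 <= a <= (size mu).+1) :
  fcoef lam mu nu
    <= fcoef (add_ones a lam) (add_ones a.-1 mu) (add_ones 1 nu).
Proof.
rewrite {1}/fcoef; case: ifP => // /diagram_subset sub.
(* The insertions of all tableaux counted on the left form a list of tableaux for the right side,
   free of repetitions by injectivity. *)
rewrite cardE -(size_map (fun U => insertion a (to_filling U))).
apply: leq_size_fcoef.
- by apply/diagram_subset => i; rewrite !nth_add_ones; have := sub i; lia.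
- rewrite map_inj_in_uniq ?enum_uniq // => U V.
  rewrite !mem_enum !inE => /and3P[tabU _ _] /and3P[tabV _ _] E.
  exact/to_filling_inj/(insertion_inj hlam hmu ha tabU tabV).
apply/allP => _ /mapP[U + ->]; rewrite mem_enum inE.
exact: insertion_amenable_tableau.
Qed.
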